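(* Let $E\subseteq F$ be countable Borel equivalence relations on a standard Borel space $X$ such that $E$ is normal in $F$ and every $F$-class contains only finitely many $E$-classes. Then there is an $(E,F)$-link.
   Context: A countable Borel equivalence relation (CBER) is a Borel equivalence relation with countable classes. $\mathrm{Aut}_B(E)$ is the group of Borel bijections $T:X\to X$ with $x\mathrel E y\iff T(x)\mathrel E T(y)$. $E$ is normal in $F$ if there is a countable subgroup $G\le\mathrm{Aut}_B(E)$ with $F = E^{\vee G}$, where $x\mathrel{E^{\vee G}}y\iff\exists g\in G\,(g(x)\mathrel E y)$. For CBERs $E\subseteq F$, an $(E,F)$-link is a CBER $L\subseteq F$ such that for every $F$-class $C$, every $(E\upharpoonright C)$-class meets every $(L\upharpoonright C)$-class in exactly one point. *)

(* Defs.v *)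
From HB Require Import structures.
From Corelib Require Import RelationClasses.
From mathcomp Require Import all_boot all_order all_algebra.
From mathcomp Require Import all_classical all_reals.
From mathcomp Require Import topology measure.

Set Implicit Arguments.
Unset Strict Implicit.
Unset Printing Implicit Defensive.

Local Open Scope classical_set_scope.

(** Completeness is that of [completeType], stated without its requirement that
    the carrier be pointed. *)
Definition complete_metric (R : realType) (M : metricType R) : Prop :=
  forall G : set_system M, ProperFilter G -> cauchy G -> exists x : M, G --> x.

Definition separable (M : topologicalType) : Prop :=
  exists2 D : set M, countable D & dense D.

(** A measurable space is given by its carrier [X : Type] and its set system [B],
    because a [measurableType] is pointed and would exclude the empty space.
    [(X, B)] is standard Borel when it is isomorphic to [(M, Borel(M))] for a
    Polish space [M]; since [f] is bijective, the equivalence below says that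
    [f] and its inverse are both measurable. *)
Definition standard_borel (R : realType) (X : Type) (B : set (set X)) : Prop :=
  exists (M : metricType R) (f : X -> M),
    [/\ complete_metric M, separable M, bijective f &
        forall A : set M, B (f @^-1` A) <-> <<s @open M >> A].

Definition prod_borel (X : Type) (B : set (set X)) : set (set (X * X)) :=
  <<s [set A `*` C | A in B & C in B] >>.

Definition borel_map (X : Type) (B : set (set X)) (T : X -> X) : Prop :=
  forall A, B A -> B (T @^-1` A).

(** The class of [x] is the set [E x]. *)
Definition cber (X : Type) (B : set (set X)) (E : X -> X -> Prop) : Prop :=
  [/\ Equivalence E, prod_borel B [set p | E p.1 p.2] &
      forall x, countable (E x)].

Definition AutB (X : Type) (B : set (set X)) (E : X -> X -> Prop) :
    set (X -> X) :=
  [set T | [/\ bijective T, borel_map B T &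
               forall x y, E x y <-> E (T x) (T y)]].

Definition subgroup_of (X : Type) (A G : set (X -> X)) : Prop :=
  [/\ G `<=` A, G id,
      forall g h, G g -> G h -> G (g \o h) &
      forall g, G g -> exists h, [/\ G h, cancel g h & cancel h g]].

Definition join_action (X : Type) (E : X -> X -> Prop) (G : set (X -> X)) :
    X -> X -> Prop :=
  fun x y => exists2 g, G g & E (g x) y.

Definition normal_in (X : Type) (B : set (set X)) (E F : X -> X -> Prop) :
    Prop :=
  exists G : set (X -> X),
    [/\ subgroup_of (AutB B E) G, countable G &
        forall x y, F x y <-> join_action E G x y].

Definition eq_classes (X : Type) (E : X -> X -> Prop) : set (set X) :=
  [set C | exists x, C = E x].

(** The classes of the restriction of [E] to [C]. *)
Definition restr_classes (X : Type) (E : X -> X -> Prop) (C : set X) :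
    set (set X) :=
  [set D | exists2 x, C x & D = E x `&` C].

Definition is_link (X : Type) (B : set (set X)) (E F L : X -> X -> Prop) :
    Prop :=
  [/\ cber B L,
      forall x y, L x y -> F x y &
      forall C, eq_classes F C ->
        forall D K, restr_classes E C D -> restr_classes L C K ->
          exists! z, (D `&` K) z].

(* Main.v *)
(** Let [G = {g_0, g_1, ...}] be the countable group with [F = E^{\/G}], let [F']
    be its orbit relation and [E' = E /\ F'].  Every [G]-orbit meets every [E]-class
    of its [F]-class, so an [(E', F')]-link is an [(E, F)]-link; for [E'] and [F']
    the quantifiers over a class are quantifiers over indices [k], which is what
    keeps all constructions Borel without any uniformization theorem.

    Greedily choose a maximal Borel family of pairwise disjoint finite sets that
    are transversals for the [E']-classes of an orbit; call a point covered when it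
    lies in one of them.  By maximality each orbit has a full class, one all of
    whose points are covered.  On orbits with no uncovered point the family is a
    link.  On any other orbit [C], send [x] by the first [g_k] that takes it into a
    full class, then back to the class of [x] along the block of [g_k x].  As [g_k]
    depends only on the class of [x], this is an injection of each class into its
    covered points, so the nonfull classes are compressible, hence, transporting
    by [G], all classes of [C] are.  Compressibility gives an injection of [C] into
    each of its classes, and Schroeder-Bernstein turns it into bijections
    [phi_D : C -> D]; the link classes on [C] are the sets [{phi_D y | D}]. *)

Require Import Defs.
From Corelib Require Import RelationClasses.
From mathcomp Require Import all_boot all_order all_algebra.
From mathcomp Require Import all_classical all_reals.
From mathcomp Require Import topology measure.
From mathcomp Require Import lra.
Import Order.TTheory GRing.Theory Num.Theory.

Set Implicit Arguments.
Unset Strict Implicit.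

Local Open Scope classical_set_scope.

(** * Least witnesses *)

(* [least Q] is 0 when no index satisfies [Q]. *)
Definition least (Q : nat -> Prop) : nat :=
  if pselect (exists n, `[< Q n >]) is left h then ex_minn h else 0.

Lemma leastP (Q : nat -> Prop) : (exists n, Q n) -> Q (least Q).
Proof.
move=> [n Qn]; rewrite /least; case: pselect => [h|]; last first.
  by case; exists n; apply/asboolP.
by case: ex_minnP => m /asboolP.
Qed.

Lemma leastE (Q : nat -> Prop) (m : nat) :
  least Q = m <->
  (Q m /\ forall j, (j < m)%N -> ~ Q j) \/ (m = 0%N /\ forall j, ~ Q j).
Proof.
rewrite /least; case: pselect => [h|h]; last first.
  have hQ j : ~ Q j by move=> Qj; apply: h; exists j; apply/asboolP.
  by split=> [<-|[[/hQ//]|[->]//]]; right.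
case: ex_minnP => n /asboolP Qn nmin; split=> [<-|].
  left; split=> // j jn Qj.
  by have := nmin j (introT (asboolP _) Qj); rewrite leqNgt jn.
case=> [[Qm mmin]|[_ /(_ _ Qn)//]].
apply/eqP; rewrite eqn_leq nmin; last exact/asboolP.
by rewrite leqNgt; apply/negP => /mmin.
Qed.

(** * Borel predicates and maps under countable operations *)

Section MeasurablePredicates.
Variables (X : Type) (B : set (set X)).
Hypothesis sB : sigma_algebra setT B.

Local Notation mP P := (B [set x | P x]).

Lemma mpred_eq (P Q : X -> Prop) :
  (forall x, P x <-> Q x) -> mP Q -> mP P.
Proof.
by move=> PQ; rewrite (_ : [set x | P x] = [set x | Q x]) //; apply/seteqP;
  split=> x /PQ.
Qed.

Lemma mpred_not (P : X -> Prop) : mP P -> B [set x | ~ P x].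
Proof. by case: sB => _ sC _ /sC; rewrite setTD. Qed.

Lemma mpred_cst (P : Prop) : B [set x | P].
Proof.
case: sB => s0 sC _; case: (pselect P) => p.
  by apply: (mpred_eq (Q := setT)) => //; rewrite -(setD0 setT); apply: sC.
by apply: (mpred_eq (Q := set0)).
Qed.

Lemma mpred_ex (P : X -> nat -> Prop) :
  (forall n, B [set x | P x n]) -> B [set x | exists n, P x n].
Proof.
case: sB => _ _ sU /sU; apply: mpred_eq => x.
by split=> [[n Pn]|[n _ Pn]]; exists n.
Qed.

Lemma mpred_all (P : X -> nat -> Prop) :
  (forall n, B [set x | P x n]) -> B [set x | forall n, P x n].
Proof.
move=> mPn; apply: (mpred_eq (Q := fun x => ~ exists n, ~ P x n)).
  move=> x; split=> [Px [n] /(_ (Px n))//|nP n].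
  by apply: contrapT => nPn; apply: nP; exists n.
by apply: mpred_not; apply: mpred_ex => n; apply: mpred_not.
Qed.

Lemma mpred_and (P Q : X -> Prop) : mP P -> mP Q -> B [set x | P x /\ Q x].
Proof.
move=> mP mQ; apply: (mpred_eq
  (Q := fun x => forall n, if n is 0%N then P x else Q x)).
  move=> x; split=> [[Px Qx] []//|PQ].
  by split; [exact: (PQ 0%N)|exact: (PQ 1%N)].
by apply: mpred_all => -[|n].
Qed.

Lemma mpred_or (P Q : X -> Prop) : mP P -> mP Q -> B [set x | P x \/ Q x].
Proof.
move=> mP mQ; apply: (mpred_eq
  (Q := fun x => exists n, if n is 0%N then P x else Q x)).
  move=> x; split=> [[Px|Qx]|[[|n] ?]]; [by exists 0%N|by exists 1%N|..];
    by [left|right].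
by apply: mpred_ex => -[|n].
Qed.

Lemma mpred_imp (P Q : X -> Prop) : mP P -> mP Q -> B [set x | P x -> Q x].
Proof.
move=> mP mQ; apply: (mpred_eq (Q := fun x => ~ P x \/ Q x)).
  move=> x; split=> [PQ|[]//]; case: (pselect (P x)) => p; last by left.
  by right; apply: PQ.
by apply: mpred_or => //; apply: mpred_not.
Qed.

Lemma borel_comp (f h : X -> X) :
  borel_map B f -> borel_map B h -> borel_map B (fun x => f (h x)).
Proof. by move=> mf mh A /mf /mh. Qed.

Definition borel_index (K : X -> nat) : Prop := forall m, B [set x | K x = m].

(** The sets [K x = n] are Borel and countable in number, so an index chosen by [least] may occur in
    a Borel predicate. *)
Lemma mpred_case (K : X -> nat) (P : X -> nat -> Prop) :
  borel_index K -> (forall n, B [set x | P x n]) -> B [set x | P x (K x)].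
Proof.
move=> mK mPn; apply: (mpred_eq (Q := fun x => exists n, K x = n /\ P x n)).
  by move=> x; split=> [|[n [->]]//]; exists (K x).
by apply: mpred_ex => n; apply: mpred_and.
Qed.

Lemma borel_case (K : X -> nat) (f : nat -> X -> X) :
  borel_index K -> (forall n, borel_map B (f n)) ->
  borel_map B (fun x => f (K x) x).
Proof.
move=> mK mf A BA; apply: (mpred_case (P := fun x n => A (f n x))) => // n.
exact: mf.
Qed.

Lemma borel_index_least (P : X -> nat -> Prop) :
  (forall n, B [set x | P x n]) -> borel_index (fun x => least (P x)).
Proof.
move=> mPn m; apply: mpred_eq (fun x => leastE _ _) _.
apply: mpred_or; apply: mpred_and => //; [|exact: mpred_cst|].
  apply: mpred_all => j; apply: mpred_imp; first exact: mpred_cst.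
  exact: mpred_not.
by apply: mpred_all => j; exact: mpred_not.
Qed.

Lemma borel_if (P : X -> Prop) (f h : X -> X) :
  mP P -> borel_map B f -> borel_map B h ->
  borel_map B (fun x => if pselect (P x) then f x else h x).
Proof.
move=> mp mf mh A BA.
apply: (mpred_eq (Q := fun x => (P x -> A (f x)) /\ (~ P x -> A (h x)))).
  move=> x /=; case: (pselect (P x)) => p; split=> [Ax|[Af Ah]].
  - by split.
  - exact: Af.
  - by split.
  - exact: Ah.
apply: mpred_and; apply: mpred_imp; first exact: mp; first exact: mf.
  exact: mpred_not.
exact: mh.
Qed.

Lemma borel_iter (f : X -> X) : borel_map B f ->
  forall n, borel_map B (iter n f).
Proof. by move=> mf; elim=> [//|n IH] A /mf; apply: IH. Qed.

(** The sets of pairs whose preimage under [x |-> (f x, h x)] lies in [B] form a sigma-algebra that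
    contains the rectangles. *)
Lemma mpred_prod (E : X -> X -> Prop) (f h : X -> X) :
  prod_borel B [set p | E p.1 p.2] -> borel_map B f -> borel_map B h ->
  B [set x | E (f x) (h x)].
Proof.
move=> mE mf mh.
pose S := [set A : set (X * X) | B [set x | A (f x, h x)]].
suff: prod_borel B `<=` S by move/(_ _ mE).
apply: smallest_sub; first split.
- exact: mpred_cst.
- by move=> A /mpred_not; apply: mpred_eq => x; split=> [[]|].
- move=> A mA; apply: (mpred_eq (Q := fun x => exists n, A n (f x, h x))).
    by move=> x; split=> [[n _ An]|[n An]]; exists n.
  exact: mpred_ex.
by move=> _ [A BA [C BC <-]]; apply: mpred_and; [exact: mf|exact: mh].
Qed.

Section Separated.
Variable S : nat -> set X.
Hypothesis mS : forall n, B (S n).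
Hypothesis sepS : forall x y, (forall n, S n x <-> S n y) -> x = y.

(** Points in the same sets [S n] are equal, which turns equality into a countable conjunction of
    Borel conditions. *)
Lemma mpred_eqf (f h : X -> X) : borel_map B f -> borel_map B h ->
  B [set x | f x = h x].
Proof.
move=> mf mh; apply: (mpred_eq
  (Q := fun x => forall n,
    (S n (f x) -> S n (h x)) /\ (S n (h x) -> S n (f x)))).
  by move=> x; split=> [->//|Sx]; apply: sepS => n; split; apply Sx.
apply: mpred_all => n; apply: mpred_and; apply: mpred_imp;
  by [exact: mf (mS n)|exact: mh (mS n)].
Qed.

End Separated.
End MeasurablePredicates.

(** * Borel graphs and separating sequences *)

(** [L] is the union over [k] of the graphs of [g k] restricted to the Borel sets where
    [L x (g k x)]; the equation [y = g k x] is tested on the sets [S n]. *)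
Lemma prod_borel_graph_union (X : Type) (B : set (set X)) (S : nat -> set X)
    (L : X -> X -> Prop) (g : nat -> X -> X) :
  sigma_algebra setT B -> (forall n, B (S n)) ->
  (forall x y, (forall n, S n x <-> S n y) -> x = y) ->
  (forall k, borel_map B (g k)) -> (forall x y, L x y -> exists k, y = g k x) ->
  (forall k, B [set x | L x (g k x)]) -> prod_borel B [set p | L p.1 p.2].
Proof.
move=> sB mS sepS mg Lg mL.
have sP : sigma_algebra setT (prod_borel B) by exact: smallest_sigma_algebra.
have BT : B setT by apply: mpred_eq (mpred_cst sB True).
have fstP A : B A -> prod_borel B [set p | A p.1].
  move=> BA; apply: sub_sigma_algebra; exists A => //; exists setT => //.
  by apply/seteqP; split=> p //= [].
have sndP A : B A -> prod_borel B [set p | A p.2].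
  move=> BA; apply: sub_sigma_algebra; exists setT => //; exists A => //.
  by apply/seteqP; split=> p //= [].
move: (prod_borel B) sP fstP sndP => PB sP fstP sndP.
apply: (mpred_eq (Q := fun p : X * X => exists k, L p.1 (g k p.1) /\
    forall n, (S n p.2 -> S n (g k p.1)) /\ (S n (g k p.1) -> S n p.2))).
  case=> x y /=; split=> [Lxy|[k [Lk eqk]]].
    by have [k yE] := Lg _ _ Lxy; exists k; rewrite -yE.
  by rewrite (sepS y (g k x)) // => n; split; apply eqk.
apply: mpred_ex => // k; apply: mpred_and => //; first exact: fstP (mL k).
by apply: mpred_all => // n; apply: mpred_and => //; apply: mpred_imp => //;
  do ?[exact: sndP|exact: fstP (mg k _ (mS n))].
Qed.

(** The separating sets come from interiors of balls around a countable dense set, with radii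
    tending to 0: points in the same such sets are arbitrarily close. *)
Lemma standard_borel_separated (R : realType) (X : Type) (B : set (set X)) :
  standard_borel R B ->
  sigma_algebra setT B /\
  exists S : nat -> set X, (forall n, B (S n)) /\
    forall x y, (forall n, S n x <-> S n y) -> x = y.
Proof.
move=> [M [f [_ [D cD dD] [h fK hK] Bf]]]; split.
  have BE A : B A <-> <<s @open M >> (h @^-1` A).
    rewrite -Bf (_ : f @^-1` (h @^-1` A) = A) //.
    by apply/seteqP; split=> x /=; rewrite fK.
  have [s0 sC sU] := smallest_sigma_algebra setT (@open M).
  split=> [|A BA|A BA]; apply/(BE _).2 => //.
    by rewrite setTD -preimage_setC -setTD; exact: sC _ ((BE _).1 BA).
  by rewrite preimage_bigcup; exact: sU _ (fun n => (BE _).1 (BA n)).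
have [c cinj] := countable_injP _ cD.
pose r n : R := (n.+1%:R^-1)%R.
(* [n] codes the centre and [m] the radius. The radius is twice [r m] so that a point within [r m]
   of a centre is interior to its ball. *)
pose U n m : set M :=
  \bigcup_(d in [set d | D d /\ c d = n]) (ball d (r m + r m)%R)^°.
exists (fun n => if unpickle n is Some p then f @^-1` U p.1 p.2 else set0).
split=> [n|x y Sxy].
  case: unpickle => [p|]; last first.
    rewrite -(preimage_set0 f); apply/Bf.
    by case: (smallest_sigma_algebra setT (@open M)).
  apply/Bf; refine (sub_sigma_algebra _).
  by apply: bigcup_open => d _; exact: open_interior.
have Uxy n m : U n m (f x) -> U n m (f y).
  move=> Ux; have := Sxy (pickle (n, m)); rewrite pickleK /= => /iffLR.
  exact.
rewrite -(fK x) -(fK y); congr h; apply: metric_hausdorff => A C.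
move=> /nbhs_ballP[e /= e0 eA] yC.
exists (f y); split; last exact: nbhs_singleton yC.
apply: eA.
(* A third of [e] suffices: [d] will be within [r m] of [f x] and within twice [r m] of [f y]. *)
have [m] := ltr_add_invr (divr_gt0 e0 (ltr0n R 3)); rewrite add0r -/(r m) => me.
have r0 : (0 < r m)%R by rewrite invr_gt0.
have [d [/interior_subset dx Dd]] : (ball (f x) (r m))^° `&` D !=set0.
  apply: dD; last exact: open_interior.
  by exists (f x); apply: nbhsx_ballx.
have [d' [Dd' cd'] /interior_subset dy] : U (c d) m (f y).
  apply: Uxy; exists d => //.
  apply: filterS (nbhsx_ballx (f x) (r m) _) => // z.
  exact: ball_triangle (ball_sym dx).
have dd' : d' = d by apply: cinj => //; rewrite inE.
apply: le_ball (ball_triangle dx _); last by rewrite -dd'; exact: dy.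
by lra.
Qed.

(** * The setting: an enumerated group and a relation [E] inside its orbit relation *)

Section Link.
Variables (X : Type) (B : set (set X)) (S : nat -> set X).
Hypothesis sB : sigma_algebra setT B.
Hypothesis mS : forall n, B (S n).
Hypothesis sepS : forall x y, (forall n, S n x <-> S n y) -> x = y.
Variables (g : nat -> X -> X) (inv : nat -> nat).
Hypothesis mg : forall k, borel_map B (g k).
Hypothesis gK : forall k, cancel (g k) (g (inv k)).
Hypothesis gVK : forall k, cancel (g (inv k)) (g k).
Hypothesis g1 : exists e, forall x, g e x = x.
Hypothesis gM : forall i j, exists k, forall x, g i (g j x) = g k x.

Definition orbit_rel (x y : X) : Prop := exists k, y = g k x.
Local Notation F := orbit_rel.

Variable E : X -> X -> Prop.
Hypothesis eqE : Equivalence E.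
Hypothesis mE : forall f h : X -> X, borel_map B f -> borel_map B h ->
  B [set x | E (f x) (h x)].
Hypothesis EF : forall x y, E x y -> F x y.
Hypothesis Eg : forall k x y, E x y <-> E (g k x) (g k y).
Hypothesis Efin : forall x, finite_set (range (fun k => E (g k x))).

Let Erefl x : E x x. Proof. exact: (@Equivalence_Reflexive _ _ eqE). Qed.
Let Esym x y : E x y -> E y x.
Proof. exact: (@Equivalence_Symmetric _ _ eqE). Qed.
Let Etrans y x z : E x y -> E y z -> E x z.
Proof. exact: (@Equivalence_Transitive _ _ eqE). Qed.

Lemma orbit_g k x : F x (g k x). Proof. by exists k. Qed.

Lemma orbit_refl x : F x x.
Proof. by have [e ge] := g1; exists e; rewrite ge. Qed.

Lemma orbit_sym x y : F x y -> F y x.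
Proof. by move=> [k ->]; exists (inv k); rewrite gK. Qed.

Lemma orbit_trans y x z : F x y -> F y z -> F x z.
Proof. by move=> [k ->] [j ->]; have [i gi] := gM j k; exists i. Qed.

Lemma borel_g k f : borel_map B f -> borel_map B (fun x => g k (f x)).
Proof. by move=> mf; apply: borel_comp. Qed.

(** * A maximal disjoint family of finite transversals *)

Fixpoint cell (u : seq (nat * bool)) (x : X) : Prop :=
  if u is p :: u' then (if p.2 then S p.1 x else ~ S p.1 x) /\ cell u' x
  else True.

Lemma mpred_cell u : B (cell u).
Proof.
elim: u => [|[n b] u IH]; first exact: (mpred_cst sB True).
apply: mpred_and => //; case: b => /=; [exact: mS|exact: mpred_not (mS n)].
Qed.

(** For each listed point other than [x], the cell receives a set [S n] that tells it from [x], with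
    the sign that holds at [x]. *)
Lemma cell_sep (I : eqType) (s : seq I) (p : I -> X) x :
  exists u, cell u x /\ forall i, i \in s -> cell u (p i) -> p i = x.
Proof.
elim: s => [|i s [u [ux us]]]; first by exists [::].
case: (pselect (p i = x)) => [pix|pix].
  exists u; split=> // j; rewrite inE => /orP[/eqP->//|]; exact: us.
have [n nS] : exists n, ~ (S n (p i) <-> S n x).
  by apply: contrapT => h; apply: pix; apply: sepS => n; apply: contrapT => hn;
    apply: h; exists n.
exists ((n, `[< S n x >]) :: u); split=> /=.
  by split=> //; case: asboolP.
move=> j; rewrite inE => /orP[/eqP-> [Sn _]|js [_]]; last exact: us.
by case: nS; move: Sn; case: asboolP.
Qed.

Definition transversal_at (s : seq nat) (x : X) : Prop :=
  (forall i j, i \in s -> j \in s -> E (g i x) (g j x) -> i = j) /\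
  (forall k, exists i, i \in s /\ E (g i x) (g k x)).

(** Every pair of an index list and a cell occurs as a stage. A number that codes no pair gets the
    empty list, which is never a transversal, so its stage adds no block. *)
Definition stage (k : nat) : seq nat * seq (nat * bool) :=
  odflt ([::], [::]) (unpickle k).

(* The block of base point [x] at stage [k] is [{g i x | i in s}].  The last
   clause makes distinct base points of one stage have disjoint blocks. *)
Definition base (D : set X) (k : nat) (x : X) : Prop :=
  let: (s, u) := stage k in
  [/\ transversal_at s x, cell u x, forall i, i \in s -> ~ D (g i x) &
      forall i j, i \in s -> j \in s -> cell u (g (inv j) (g i x)) ->
        g (inv j) (g i x) = x].

(** The greedy step: stage [k'] admits only blocks that avoid all blocks of earlier stages. *)
Fixpoint used (k : nat) : set X :=
  if k is k'.+1 then
    [set y | used k' y \/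
       exists i, i \in (stage k').1 /\ base (used k') k' (g (inv i) y)]
  else set0.

(** The base point is written [g (inv i) y], so that all quantifiers run over indices and the
    relation is visibly Borel; [blocksP] restores it as a variable. *)
Definition blocks (y z : X) : Prop := exists k i j,
  [/\ i \in (stage k).1, j \in (stage k).1,
      base (used k) k (g (inv i) y) & z = g j (g (inv i) y)].

Definition covered (x : X) : Prop := blocks x x.
Local Notation L0 := blocks.
Local Notation D := covered.

Lemma blocksP y z : L0 y z <-> exists k x i j,
  [/\ i \in (stage k).1 /\ j \in (stage k).1, base (used k) k x,
      y = g i x & z = g j x].
Proof.
split=> [[k [i [j [si sj bx ->]]]]|[k [x [i [j [[si sj] bx -> ->]]]]]].
  by exists k, (g (inv i) y), i, j; split=> //; rewrite gVK.
by exists k, i, j; rewrite !gK.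
Qed.

Lemma mpred_base A k : B A -> B (base A k).
Proof.
move=> BA; apply: (mpred_eq (Q := fun x =>
  let: (s, u) := stage k in
  transversal_at s x /\ (cell u x /\ ((forall i, i \in s -> ~ A (g i x)) /\
      (forall i j, i \in s -> j \in s -> cell u (g (inv j) (g i x)) ->
        g (inv j) (g i x) = x))))).
  by rewrite /base; case: stage => s u x; split=> [[]|[? [? []]]].
case: (stage k) => s u.
apply: mpred_and => //; first apply: mpred_and => //.
- do 2![apply: mpred_all => // ?].
  do 2![apply: mpred_imp => //; first exact: mpred_cst].
  apply: mpred_imp => //; last exact: mpred_cst.
  by apply: mE; apply: mg.
- apply: mpred_all => // n; apply: mpred_ex => // i.
  apply: mpred_and => //; first exact: mpred_cst.
  by apply: mE; apply: mg.
apply: mpred_and => //; first exact: mpred_cell.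
apply: mpred_and => //.
  apply: mpred_all => // i; apply: mpred_imp => //; first exact: mpred_cst.
  by apply: mpred_not => //; apply: mg.
do 2![apply: mpred_all => // ?].
do 2![apply: mpred_imp => //; first exact: mpred_cst].
apply: mpred_imp => //.
  exact: (borel_g _ (@mg _)) (mpred_cell u).
apply: (mpred_eqf sB mS sepS) => //; apply: borel_g; exact: mg.
Qed.

Lemma mpred_used k : B (used k).
Proof.
elim: k => [|k IH]; first by case: sB.
apply: mpred_or => //; apply: mpred_ex => // i.
apply: mpred_and => //; first exact: mpred_cst.
by apply: mg; apply: mpred_base.
Qed.

Lemma mpred_blocks f h : borel_map B f -> borel_map B h ->
  B [set x | L0 (f x) (h x)].
Proof.
move=> mf mh; apply: mpred_ex => // k; do 2![apply: mpred_ex => // ?].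
under eq_set => x do rewrite and4E.
apply: mpred_and => //; first exact: mpred_cst.
apply: mpred_and => //; first exact: mpred_cst.
apply: mpred_and => //.
  exact: (borel_g _ mf) (mpred_base _ (mpred_used _)).
by apply: (mpred_eqf sB mS sepS) => //; do 2!apply: borel_g.
Qed.

Lemma used_mono k k' : (k <= k')%N -> used k `<=` used k'.
Proof.
elim: k' => [|k' IH]; first by rewrite leqn0 => /eqP->.
rewrite leq_eqVlt ltnS => /orP[/eqP->//|/IH kk'] y /kk'; by left.
Qed.

Lemma used_covered k y : used k y -> D y.
Proof.
elim: k => //= k IH [/IH//|[i [si bi]]].
by exists k, i, i; rewrite gVK.
Qed.

Lemma base_used k x i : base (used k) k x -> i \in (stage k).1 ->
  used k.+1 (g i x).
Proof. by move=> bx si; right; exists i; rewrite gK. Qed.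

Lemma base_fresh k x i : base (used k) k x -> i \in (stage k).1 ->
  ~ used k (g i x).
Proof. by rewrite /base; case: stage => s u [_ _ + _] si; apply. Qed.

(** Blocks of different stages are disjoint by freshness. Within one stage, [x] is
    [g (inv i) (g i' x')] and lies in the cell, so the last clause of [base] at [x'] gives
    [x = x']. *)
Lemma base_inj k x i k' x' i' : base (used k) k x -> base (used k') k' x' ->
  i \in (stage k).1 -> i' \in (stage k').1 -> g i x = g i' x' ->
  k = k' /\ x = x'.
Proof.
move=> bx bx' si si' e.
have kk' : k = k'.
  case: (ltngtP k k') => // /used_mono sub.
    by case: (base_fresh bx' si'); rewrite -e; apply: sub; apply: base_used.
  by case: (base_fresh bx si); rewrite e; apply: sub; apply: base_used.
split=> //; subst k'; move: bx bx' si si'; rewrite /base.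
case: stage => s u /= [_ ux _ _] [_ ux' _ uj] si si'.
by have := uj i' i si' si; rewrite -e gK => /(_ ux).
Qed.

Lemma blocks_sym y z : L0 y z -> L0 z y.
Proof.
move=> /blocksP[k [x [i [j [[si sj] bx yE zE]]]]].
by apply/blocksP; exists k, x, j, i.
Qed.

Lemma blocks_trans y x z : L0 x y -> L0 y z -> L0 x z.
Proof.
move=> /blocksP[k [w [i [j [[si sj] bw xE yE]]]]].
move=> /blocksP[k' [w' [i' [j' [[si' sj'] bw' yE' zE]]]]].
have [kk' ww'] := base_inj bw bw' sj si' (etrans (esym yE) yE').
subst k' w'; by apply/blocksP; exists k, w, i, j'.
Qed.

Lemma blocks_covered y z : L0 y z -> D z.
Proof. by move=> yz; exact: blocks_trans (blocks_sym yz) yz. Qed.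

Lemma blocks_orbit y z : L0 y z -> F y z.
Proof.
move=> [k [i [j [_ _ _ ->]]]]; exact: orbit_trans (orbit_g _ _) (orbit_g _ _).
Qed.

Lemma blocks_E y z : L0 y z -> E y z -> y = z.
Proof.
move=> /blocksP[k [x [i [j [[si sj] bx -> ->]]]]] Eij.
move: si sj bx; rewrite /base; case: stage => s u si sj [[inj _] _ _ _].
by rewrite (inj _ _ si sj Eij).
Qed.

Lemma blocks_meet y d : D y -> F y d -> exists z, L0 y z /\ E d z.
Proof.
move=> /blocksP[k [x [i [_ [[si _] bx yE _]]]]] yd.
have [m dm] : F x d by apply: orbit_trans yd; rewrite yE; apply: orbit_g.
have [j [sj Ej]] : exists j, j \in (stage k).1 /\ E (g j x) (g m x).
  by move: bx; rewrite /base; case: stage => s u [[_ +] _ _ _]; apply.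
exists (g j x); split; last by rewrite dm; apply: Esym.
by apply/blocksP; exists k, x, i, j.
Qed.

(** * Full classes *)

Definition full (y : X) : Prop := forall k, E y (g k y) -> D (g k y).

Lemma fullP y : full y <-> forall z, E y z -> D z.
Proof.
split=> [fy z Ez|fy k /fy//].
by have [k zk] := EF Ez; move: Ez; rewrite zk; apply: fy.
Qed.

(* Otherwise every class of the orbit has an uncovered point, and a transversal
   made of such points would have been used at some stage. *)
Lemma full_exists x : exists k, full (g k x).
Proof.
apply: contrapT => nfull.
pose c k := least (fun j => E (g k x) (g j x) /\ ~ D (g j x)).
have cP k : E (g k x) (g (c k) x) /\ ~ D (g (c k) x).
  apply: (@leastP (fun j => E (g k x) (g j x) /\ ~ D (g j x))).
  apply: contrapT => h; apply: nfull; exists k; apply/fullP.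
  move=> z Ez; apply: contrapT => nDz; apply: h.
  have [j zj] : F x z by apply: orbit_trans (EF Ez); apply: orbit_g.
  by exists j; rewrite -zj.
have cE k k' : E (g k x) (g k' x) -> c k = c k'.
  move=> Ek; congr least; apply/funext => j; apply/propext.
  split=> -[Ej nD]; split=> //; apply: Etrans Ej => //; exact: Esym.
(* By [cE] the map [c] factors through the finitely many classes of the orbit, so its range is a
   finite transversal index set. *)
have [s sE] : exists s : seq nat, range c = [set` s].
  apply/finite_seqP.
  pose w (A : set X) := least (fun j => A (g j x) /\ ~ D (g j x)).
  have -> : range c = w @` range (fun k => E (g k x)).
    by rewrite image_comp.
  exact: finite_image.
have sP i : i \in s <-> exists k, i = c k.
  split=> [si|[k ->]].
    have : [set` s] i by [].
    by rewrite -sE => -[k _ <-]; exists k.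
  suff : [set` s] (c k) by [].
  by rewrite -sE; exists k.
(* [u] holds at [x] and at no other of the finitely many points [g (inv j) (g i x)], as the last
   clause of [base] demands. *)
have [u [ux us]] := cell_sep [seq (i, j) | i <- s, j <- s]
  (fun p => g (inv p.2) (g p.1 x)) x.
pose K := pickle (s, u).
have sK : stage K = (s, u) by rewrite /stage pickleK.
have bK : base (used K) K x.
  rewrite /base sK; split=> //.
  - split.
      move=> i j /sP[k ->] /sP[k' ->] Ec; apply: cE.
      apply: Etrans (cP k).1 (Etrans Ec _); apply: Esym; exact: (cP k').1.
    move=> k; exists (c k); split; first by apply/sP; exists k.
    exact: Esym (cP k).1.
  - by move=> i /sP[k ->] /used_covered; apply: (cP k).2.
  by move=> i j si sj; apply: (us (i, j)); apply: allpairs_f.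
(* The block based at [x] covers the point of index [c 0], which was chosen uncovered. *)
apply: (cP 0%N).2; apply: (@used_covered K.+1); apply: base_used => //.
by rewrite sK; apply/sP; exists 0%N.
Qed.

Lemma full_E x y : E x y -> full x <-> full y.
Proof.
by move=> Exy; split=> /fullP h; apply/fullP => z Ez; apply: h;
  apply: Etrans Ez => //; apply: Esym.
Qed.

Lemma mpred_covered f : borel_map B f -> B [set x | D (f x)].
Proof. by move=> mf; apply: mpred_blocks. Qed.

Lemma mpred_full f : borel_map B f -> B [set x | full (f x)].
Proof.
move=> mf; apply: mpred_all => // k; apply: mpred_imp => //.
  by apply: mE => //; apply: borel_g.
by apply: mpred_covered; apply: borel_g.
Qed.

(** * An injection of each class into its covered points *)

Definition full_index (x : X) : nat := least (fun k => full (g k x)).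

(** The inner [least] finds an index for the only point that the block of [g (full_index x) x] has
    in the class of [x]; going through an index keeps the map Borel. *)
Definition shift (x : X) : X :=
  g (least (fun j => L0 (g (full_index x) x) (g j x) /\ E x (g j x))) x.
Local Notation sigma := shift.

Lemma shiftP x : L0 (g (full_index x) x) (sigma x) /\ E x (sigma x).
Proof.
rewrite /shift; set y := g _ x.
apply: (@leastP (fun j => L0 y (g j x) /\ E x (g j x))).
have Dy : D y by have /fullP/(_ _ (Erefl _)) := leastP (full_exists x).
have [z [Lz Ez]] := blocks_meet Dy (orbit_sym (orbit_g _ x)).
by have [j zj] := EF Ez; exists j; rewrite -zj.
Qed.

Lemma shift_covered x : D (sigma x).
Proof. exact: blocks_covered (shiftP x).1. Qed.

(** Equal images force [E x x'], hence the same [full_index]. The two points it leads to are then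
    [E]-related and in one block, and a block meets a class only once. *)
Lemma shift_inj : injective sigma.
Proof.
move=> x x' e; have [Lx Ex] := shiftP x; have [Lx' Ex'] := shiftP x'.
have Exx' : E x x' by apply: Etrans Ex _; rewrite e; apply: Esym.
have kk' : full_index x = full_index x'.
  congr least; apply/funext => k; apply/propext.
  exact: full_E ((Eg k _ _).1 Exx').
rewrite -kk' -e in Lx'.
have := blocks_E (blocks_trans Lx (blocks_sym Lx')) ((Eg _ _ _).1 Exx').
exact: (can_inj (@gK _)).
Qed.

Lemma borel_shift : borel_map B sigma.
Proof.
apply: (borel_case sB) => //; apply: borel_index_least => // j.
apply: mpred_and => //.
  apply: (mpred_case sB (K := full_index)
    (P := fun x k => L0 (g k x) (g j x))).
    by apply: borel_index_least => // k; apply: mpred_full.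
  by move=> k; apply: mpred_blocks.
exact: mE.
Qed.

Lemma iter_shift_E n x : E x (iter n sigma x).
Proof. by elim: n => //= n IH; apply: Etrans IH (shiftP _).2. Qed.

(** All values of [shift] are covered, so the iterated images of the uncovered set are pairwise
    disjoint. *)
Lemma iter_shift_inj n m x y : ~ D x -> ~ D y ->
  iter n sigma x = iter m sigma y -> n = m /\ x = y.
Proof.
move=> nDx nDy; elim: n m => [|n IH] [|m] //=.
- by move=> e; case: nDx; rewrite e; apply: shift_covered.
- by move=> e; case: nDy; rewrite -e; apply: shift_covered.
by move=> /shift_inj/IH[-> ->].
Qed.

(** * Injections of an orbit with uncovered points into its classes *)

Definition bad (x : X) : Prop := exists k, ~ D (g k x).

Lemma bad_orbit x y : F x y -> bad x -> bad y.
Proof.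
move=> xy [k nD].
have [j jE] : F y (g k x) by apply: orbit_trans (orbit_sym xy) (orbit_g _ _).
by exists j; rewrite -jE.
Qed.

Definition nonfull_index (x : X) : nat := least (fun k => ~ full (g k x)).

Definition entry_index (x y : X) : nat :=
  least (fun k => ~ D (g k y) /\ E (g (nonfull_index x) x) (g k y)).

(* An uncovered point [r] of the class of [g b x], where [b = nonfull_index x],
   is moved along the pairwise disjoint sets [shift^k (~ covered)]: recording
   the index [k] of the element of the group that leads from [y] to [r] in this
   way makes [squeeze x] injective on the whole orbit. *)
Definition squeeze (x y : X) : X :=
  g (inv (nonfull_index x))
    (iter (entry_index x y) sigma (g (entry_index x y) y)).
Local Notation theta := squeeze.

(** The class of an uncovered point is not full, so [nonfull_index] does lead to a nonfull class,
    and some group element takes [y] to an uncovered point of it. *)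
Lemma entry_indexP x y : bad x -> F x y ->
  ~ D (g (entry_index x y) y) /\
  E (g (nonfull_index x) x) (g (entry_index x y) y).
Proof.
move=> [k nDk] xy.
have nf : ~ full (g (nonfull_index x) x).
  apply: (@leastP (fun k => ~ full (g k x))); exists k => /fullP fk.
  by apply: nDk; apply: fk.
apply: (@leastP (fun k => ~ D (g k y) /\ E (g (nonfull_index x) x) (g k y))).
apply: contrapT => h; apply: nf; apply/fullP => z Ez; apply: contrapT => nDz.
have [j zj] : F y z.
  apply: orbit_trans (orbit_sym xy) (orbit_trans _ (EF Ez)); exact: orbit_g.
by apply: h; exists j; rewrite -zj.
Qed.

Lemma squeeze_E x y : bad x -> F x y -> E x (theta x y).
Proof.
move=> bx xy; have [_ Ek] := entry_indexP bx xy.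
have := Etrans Ek (iter_shift_E (entry_index x y) _).
by move/(Eg (inv (nonfull_index x))); rewrite gK.
Qed.

Lemma squeeze_inj x y y' : bad x -> F x y -> F x y' ->
  theta x y = theta x y' -> y = y'.
Proof.
move=> bx xy xy' /(can_inj (@gVK _)).
have [nD _] := entry_indexP bx xy; have [nD' _] := entry_indexP bx xy'.
by move=> /(iter_shift_inj nD nD')[->] /(can_inj (@gK _)).
Qed.

(** Both least indices depend on [x] only through its class, so each class has a single
    injection. *)
Lemma squeeze_class x x' : E x x' -> theta x = theta x'.
Proof.
move=> Exx'.
have bb : nonfull_index x = nonfull_index x'.
  congr least; apply/funext => k; apply/propext.
  by have := full_E ((Eg k _ _).1 Exx'); tauto.
apply/funext => y; rewrite /squeeze /entry_index -bb.
set b := nonfull_index x.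
have -> // : (fun k => ~ D (g k y) /\ E (g b x) (g k y)) =
             (fun k => ~ D (g k y) /\ E (g b x') (g k y)).
apply/funext => k; apply/propext; have Eb := (Eg b _ _).1 Exx'.
by split=> -[nD Ek]; split=> //; apply: Etrans Ek => //; apply: Esym.
Qed.

Lemma borel_squeeze f h : borel_map B f -> borel_map B h ->
  borel_map B (fun x => theta (f x) (h x)).
Proof.
move=> mf mh.
have mb : borel_index B (fun x => nonfull_index (f x)).
  apply: borel_index_least => // k; apply: mpred_not => //; apply: mpred_full.
  exact: borel_g.
apply: (borel_case sB (K := fun x => nonfull_index (f x)) (f := fun b x =>
  g (inv b) (iter (entry_index (f x) (h x)) sigma
               (g (entry_index (f x) (h x)) (h x))))) => // b.
apply: borel_g.
apply: (borel_case sB (K := fun x => entry_index (f x) (h x))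
  (f := fun k x => iter k sigma (g k (h x)))); last first.
  move=> k; apply: (borel_comp (f := iter k sigma)); last exact: borel_g.
  exact: borel_iter borel_shift k.
apply: borel_index_least => // k; apply: mpred_and => //.
  by apply: mpred_not => //; apply: mpred_covered; apply: borel_g.
apply: (mpred_case sB (K := fun x => nonfull_index (f x))
  (P := fun x b => E (g b (f x)) (g k (h x)))) => // n.
by apply: mE; apply: borel_g.
Qed.

(** * Bijections of a bad orbit onto its classes *)

(* Schroeder-Bernstein for [squeeze x : C -> E x] and the inclusion of the class
   [E x] into its orbit [C]. *)
Definition outer (x y : X) : Prop :=
  exists m w, [/\ F x w, ~ E x w & iter m (theta x) w = y].

Definition spread (x y : X) : X :=
  if pselect (outer x y) then theta x y else y.
Local Notation phi := spread.

Lemma spread_class x x' : E x x' -> phi x = phi x'.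
Proof.
move=> Exx'; have tE := squeeze_class Exx'.
suff oE : outer x = outer x' by apply/funext => y; rewrite /spread oE tE.
apply/funext => y; apply/propext; rewrite /outer -tE.
have Fxx' := EF Exx'; split=> -[m [w [Fw nE e]]]; exists m, w; split=> //.
- exact: orbit_trans (orbit_sym Fxx') Fw.
- by move=> h; apply: nE; apply: Etrans h.
- exact: orbit_trans Fxx' Fw.
- by move=> h; apply: nE; apply: Etrans h; apply: Esym.
Qed.

(** A point of the orbit outside [E x] is outer with [m = 0], so every point left fixed is already
    in the class. *)
Lemma spread_E x y : bad x -> F x y -> E x (phi x y).
Proof.
move=> bx xy; rewrite /spread; case: (pselect (outer x y)) => [o|no] /=.
  exact: squeeze_E.
by apply: contrapT => nE; apply: no; exists 0%N, y.
Qed.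

Lemma outer_squeeze x y : outer x y -> outer x (theta x y).
Proof. by move=> [m [w [Fw nE <-]]]; exists m.+1, w. Qed.

(** In the mixed cases an image under [squeeze x] of an outer point is again outer, so it differs
    from every fixed point. *)
Lemma spread_inj x y y' : bad x -> F x y -> F x y' ->
  phi x y = phi x y' -> y = y'.
Proof.
move=> bx xy xy'; rewrite /spread.
case: (pselect (outer x y)) => [/outer_squeeze o|no] /=;
  case: (pselect (outer x y')) => [/outer_squeeze o'|no'] //=.
- exact: squeeze_inj.
- by move=> e; rewrite e in o.
- by move=> e; rewrite -e in o'.
Qed.

Lemma spread_surj x z : bad x -> E x z -> exists y, F x y /\ phi x y = z.
Proof.
move=> bx Exz; case: (pselect (outer x z)) => [|no]; last first.
  by exists z; split; [exact: EF|rewrite /spread; case: (pselect (outer x z))].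
(* [m = 0] would put [z] outside its class; otherwise the preimage is the preceding iterate, itself
   outer. *)
move=> [[|m] [w [Fw nE e]]]; first by rewrite -e in Exz.
exists (iter m (theta x) w); split.
  case: m {e} => // m; apply: EF; apply: squeeze_E => //.
  by elim: m => // m IH; apply: EF; apply: squeeze_E.
rewrite /spread; case: (pselect (outer x _)) => // -[]; by exists m, w.
Qed.

Lemma mpred_outer f h : borel_map B f -> borel_map B h ->
  B [set x | outer (f x) (h x)].
Proof.
move=> mf mh; apply: (mpred_eq (Q := fun x => exists m k,
    ~ E (f x) (g k (f x)) /\ iter m (theta (f x)) (g k (f x)) = h x)).
  move=> x; split=> [[m [w [[k ->] nE e]]]|[m [k [nE e]]]].
    by exists m, k.
  by exists m, (g k (f x)); split=> //; apply: orbit_g.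
apply: mpred_ex => // m; apply: mpred_ex => // k; apply: mpred_and => //.
  by apply: mpred_not => //; apply: mE => //; apply: borel_g.
apply: (mpred_eqf sB mS sepS) => //.
elim: m => [|m IH]; first exact: borel_g.
exact: borel_squeeze.
Qed.

Lemma borel_spread f h : borel_map B f -> borel_map B h ->
  borel_map B (fun x => phi (f x) (h x)).
Proof.
move=> mf mh; apply: (borel_if sB) => //; first exact: mpred_outer.
exact: borel_squeeze.
Qed.

(** * The link on bad orbits *)

(** [y] is the common preimage of [x] and [x'] under the bijections of the orbit onto their
    respective classes. *)
Definition spread_link (x x' : X) : Prop :=
  exists y, [/\ F x y, F x x', phi x y = x & phi x' y = x'].
Local Notation L1 := spread_link.

Lemma mpred_spread_link f h : borel_map B f -> borel_map B h ->
  B [set x | F (f x) (h x)] -> B [set x | L1 (f x) (h x)].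
Proof.
move=> mf mh mF; apply: (mpred_eq (Q := fun x => exists k, F (f x) (h x) /\
    (phi (f x) (g k (f x)) = f x /\ phi (h x) (g k (f x)) = h x))).
  move=> x; split=> [[y [[k ->] ? ? ?]]|[k [? [? ?]]]]; first by exists k.
  by exists (g k (f x)); split=> //; apply: orbit_g.
apply: mpred_ex => // k; apply: mpred_and => //.
by apply: mpred_and => //; apply: (mpred_eqf sB mS sepS) => //;
  apply: borel_spread => //; apply: borel_g.
Qed.

Lemma spread_link_refl x : bad x -> L1 x x.
Proof.
move=> bx; have [y [Fy e]] := spread_surj bx (Erefl x).
by exists y; split=> //; apply: orbit_refl.
Qed.

Lemma spread_link_sym x x' : L1 x x' -> L1 x' x.
Proof.
move=> [y [Fy Fx' e e']]; exists y; split=> //; last exact: orbit_sym.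
exact: orbit_trans (orbit_sym Fx') Fy.
Qed.

Lemma spread_link_trans y x z : bad y -> L1 x y -> L1 y z -> L1 x z.
Proof.
move=> by_ [w [Fw Fxy ex ey]] [w' [Fw' Fyz ey' ez]].
have Fyw : F y w by exact: orbit_trans (orbit_sym Fxy) Fw.
have ww' := spread_inj by_ Fyw Fw' (etrans ey (esym ey')); subst w'.
by exists w; split=> //; apply: orbit_trans Fyz.
Qed.

Lemma spread_link_E x z : L1 x z -> E x z -> x = z.
Proof. by move=> [y [_ _ ex ez]] /spread_class e; rewrite -ex -[RHS]ez e. Qed.

(** The point sought is the image, in the class of [d], of the preimage [y] of [x]. *)
Lemma spread_link_meet x d : bad x -> F x d -> exists z, L1 x z /\ E d z.
Proof.
move=> bx xd; have [y [Fy e]] := spread_surj bx (Erefl x).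
have bd := bad_orbit xd bx.
have Fdy : F d y by exact: orbit_trans (orbit_sym xd) Fy.
have Ed := spread_E bd Fdy.
exists (phi d y); split=> //; exists y; split=> //.
  exact: orbit_trans xd (EF Ed).
by rewrite -(spread_class Ed).
Qed.

(** * The link on all orbits *)

Definition orbit_link (x y : X) : Prop :=
  (bad x /\ L1 x y) \/ (~ bad x /\ L0 x y).
Local Notation L := orbit_link.

Lemma orbit_link_orbit x y : L x y -> F x y.
Proof. by case=> [[_ [w []]]|[_ /blocks_orbit]]. Qed.

Lemma not_bad_covered x : ~ bad x -> D x.
Proof.
move=> nb; apply: contrapT => nD; apply: nb; have [e ge] := g1.
by exists e; rewrite ge.
Qed.

Lemma orbit_link_equivalence : Equivalence L.
Proof.
split=> [x|x y Lxy|x y z Lxy].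
- case: (pselect (bad x)) => bx; [left|right]; split=> //.
    exact: spread_link_refl.
  exact: not_bad_covered.
- have yx := orbit_sym (orbit_link_orbit Lxy).
  case: Lxy => [[bx Lx]|[nb Lx]]; [left|right]; split.
  + exact: bad_orbit (orbit_sym yx) bx.
  + exact: spread_link_sym.
  + by move/(bad_orbit yx).
  + exact: blocks_sym.
have xy := orbit_link_orbit Lxy.
case: Lxy => [[bx Lx]|[nb Lx]] [[by_ Ly]|[nby Ly]]; [left| | |right];
  try split=> //.
- exact: spread_link_trans Lx Ly.
- by case: nby; apply: bad_orbit bx.
- by case: nb; apply: bad_orbit by_; apply: orbit_sym.
- exact: blocks_trans Lx Ly.
Qed.

Lemma orbit_link_E x z : L x z -> E x z -> x = z.
Proof. by case=> -[_]; [exact: spread_link_E|exact: blocks_E]. Qed.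

Lemma orbit_link_meet x d : F x d -> exists z, L x z /\ E d z.
Proof.
move=> xd; case: (pselect (bad x)) => bx.
  by have [z [Lz Ez]] := spread_link_meet bx xd; exists z; split=> //; left.
have [z [Lz Ez]] := blocks_meet (not_bad_covered bx) xd.
by exists z; split=> //; right.
Qed.

Lemma prod_borel_orbit_link : prod_borel B [set p | L p.1 p.2].
Proof.
apply: (prod_borel_graph_union sB mS sepS mg orbit_link_orbit) => k.
have mbad : B [set x | bad x].
  by apply: mpred_ex => // j; apply: mpred_not => //; apply: mpred_covered.
apply: mpred_or => //; apply: mpred_and => //.
- apply: mpred_spread_link => //; apply: mpred_eq (mpred_cst sB True) => x.
  by split=> // _; apply: orbit_g.
- exact: mpred_not.
- exact: mpred_blocks.
Qed.
End Link.

(** * Enumerating the group and returning to [E] and [F] *)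

Lemma countable_enum (T : Type) (G : set T) (t : T) : countable G -> G t ->
  exists g : nat -> T,
    (forall n, G (g n)) /\ forall h, G h -> exists n, g n = h.
Proof.
move=> cG Gt; have [c cinj] := countable_injP _ cG.
have /choice[g gP] n :
    exists h, G h /\ forall h', G h' -> c h' = n -> h = h'.
  case: (pselect (exists h, G h /\ c h = n)) => [[h [Gh ch]]|nh].
    by exists h; split=> // h' Gh' ch'; apply: cinj; rewrite ?inE ?ch.
  (* [t] fills the numbers that code no element of [G]. *)
  by exists t; split=> // h' Gh' ch'; case: nh; exists h'.
exists g; split=> [n|h Gh]; first by case: (gP n).
by exists (c h); apply: (gP _).2.
Qed.

Unset Implicit Arguments.

Theorem theorem5p1 (R : realType) (X : Type) (B : set (set X))
    (hX : standard_borel R B)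
    (E F : X -> X -> Prop)
    (hE : cber B E) (hF : cber B F)
    (hEF : forall x y, E x y -> F x y)
    (hnormal : normal_in B E F)
    (hfin : forall C, eq_classes F C ->
      finite_set [set D | eq_classes E D /\ D `<=` C]) :
  exists L : X -> X -> Prop, is_link B E F L.
Proof.
have [sB [S [mS sepS]]] := standard_borel_separated hX.
case: hE => eqE pE _; case: hF => eqF _ _.
have [Er Es Et] := eqE; have [Fr Fs Ft] := eqF.
case: hnormal => G [[GA G1 GM GV] cG FG].
have [g [Gg gG]] := countable_enum cG G1.
have /choice[inv invP] k : exists j, cancel (g k) (g j) /\ cancel (g j) (g k).
  by have [h [/gG[j <-] gh hg]] := GV _ (Gg k); exists j.
pose F' := orbit_rel g.
pose E' x y := E x y /\ F' x y.
have mg k : borel_map B (g k) by case: (GA _ (Gg k)).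
have gK k := (invP k).1; have gVK k := (invP k).2.
have g1 : exists e, forall x, g e x = x.
  by have [e ge] := gG _ G1; exists e; rewrite ge.
have gM i j : exists k, forall x, g i (g j x) = g k x.
  by have [k gk] := gG _ (GM _ _ (Gg i) (Gg j)); exists k; rewrite gk.
have F'F x y : F' x y -> F x y.
  by move=> [k ->]; apply/FG; exists (g k).
have F'r x : F' x x by apply: orbit_refl.
have F's x y : F' x y -> F' y x by apply: (orbit_sym gK).
have F't y x z : F' x y -> F' y z -> F' x z by apply: (orbit_trans gM).
have F'g k x : F' x (g k x) by exists k.
have Egk k x y : E x y <-> E (g k x) (g k y) by case: (GA _ (Gg k)).
have eqE' : Equivalence E'.
  split=> [x|x y [/Es ? /F's ?]|x y z [Exy Fxy] [Eyz Fyz]]; split=> //.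
    exact: Et Eyz.
  exact: F't Fyz.
have E'g k x y : E' x y <-> E' (g k x) (g k y).
  split=> -[Exy Fxy]; split.
  - exact: (Egk _ _ _).1 Exy.
  - exact: F't (F't _ _ _ (F's _ _ (F'g k x)) Fxy) (F'g k y).
  - exact: (Egk k _ _).2 Exy.
  - exact: F't (F't _ _ _ (F'g k x) Fxy) (F's _ _ (F'g k y)).
have pF' : prod_borel B [set p | F' p.1 p.2].
  apply: (prod_borel_graph_union sB mS sepS mg) => // k.
  by apply: mpred_eq (mpred_cst sB True) => x; split=> // _; exact: F'g.
have mE' f h : borel_map B f -> borel_map B h -> B [set x | E' (f x) (h x)].
  move=> mf mh; apply: mpred_and => //.
    exact: mpred_prod pE mf mh.
  exact: mpred_prod pF' mf mh.
(* The [E']-classes in the orbit of [x] are traces on it of the finitely many [E]-classes in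
   [F x]. *)
have E'fin x : finite_set (range (fun k => E' (g k x))).
  have fx := hfin (F x) (ex_intro _ x erefl).
  apply: sub_finite_set (finite_image (fun D => D `&` F' x) fx).
  move=> _ [k _ <-]; exists (E (g k x)).
    split; first by exists (g k x).
    by move=> y /hEF; apply: Ft; apply: F'F.
  apply/seteqP; split=> y [Ey Fy]; split=> //.
    by apply: F't Fy; apply: F's.
  exact: F't Fy.
have E'F' x y : E' x y -> F' x y by case.
pose L := orbit_link S g inv E'.
have LF' x y : L x y -> F' x y by move=> Lxy; apply: orbit_link_orbit Lxy.
exists L; split.
- split.
  + exact: orbit_link_equivalence.
  + exact: prod_borel_orbit_link.
  + move=> x; apply: sub_countable (countableP [set: nat]).
    apply: card_le_trans (card_image_le (fun k => g k x) setT).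
    by apply: subset_card_le => y /LF' [k ->]; exists k.
- by move=> x y /LF'/F'F.
move=> _ [x0 ->] _ _ [x Cx ->] [y Cy ->].
(* The orbit of [y] meets the [E]-class of [x], at [g k y], so the link class of [y] can be sought
   inside that orbit. *)
have /FG[_ /gG[k <-] Ekx] : F y x by apply: Ft Cx; apply: Fs.
have [z [Lz Ez]] : exists z, L y z /\ E' (g k y) z.
  by apply: orbit_link_meet (F'g k y).
exists z; split.
  have Fz : F x0 z by apply: Ft Cy _; apply: F'F; apply: LF'.
  by split; split=> //; apply: Et Ez.1; apply: Es.
(* Being linked to [y], both [z] and [z'] lie in its orbit, so they are [E']-related and not just
   [E]-related. *)
move=> z' [[Ez' _] [Lz' _]].
have eqL : Equivalence L by exact: orbit_link_equivalence.
have [_ Ls Lt] := eqL.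
have LE : L z z' -> E' z z' -> z = z' by move=> Lzz'; apply: orbit_link_E Lzz'.
apply: LE.
  by apply: Lt Lz'; apply: Ls.
split; last first.
  by apply: F't (LF' _ _ Lz'); apply: F's; apply: LF'.
exact: Et (Et _ _ _ (Es _ _ Ez.1) Ekx) Ez'.
Qed.
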